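(* Consider the averaged switched RLC circuit $-L\dot I=RI+\Gamma(u)V-B(u)V_s$, $C\dot V=\Gamma(u)^\top I-GV$ with $\Gamma(u)=u\Gamma_1+(1-u)\Gamma_0$, $B(u)=uB_1+(1-u)B_0$, and its extended dynamics $$-L\ddot I=R\dot I+\Gamma(u)\dot V+\big((\Gamma_1-\Gamma_0)V-(B_1-B_0)V_s\big)\upsilon,\quad C\ddot V=\Gamma(u)^\top\dot I+(\Gamma_1-\Gamma_0)^\top I\upsilon-G\dot V,\quad \dot u=\upsilon,$$ with state $(I,V,\dot I,\dot V,u)$ and input $\upsilon\in\mathbb{R}$. Assume: $L,C$ constant symmetric positive definite; $R,G$ symmetric positive semi-definite; $I,V$ (and $\dot I,\dot V$) are measured and $V_s$ is known and nonzero; there exist constants $V^\star\in\mathbb{R}^\rho_+$, $\bar u\in(0,1)$, $\bar I\in\mathbb{R}^\sigma$ with $0=\Gamma(\bar u)V^\star+R\bar I-B(\bar u)V_s$, $0=\Gamma(\bar u)^\top\bar I-GV^\star$; and at least one entry of $\begin{bmatrix}(\Gamma_1-\Gamma_0)V-(B_1-B_0)V_s\\(\Gamma_1-\Gamma_0)^\top I\end{bmatrix}$ is nonzero for all $(I,V)$ and all $t\ge0$. Apply the control $$\upsilon=\frac1{k_d}\big(\mu-k_i(u-\bar u)-y\big),\qquad y=\dot V^\top(\Gamma_1-\Gamma_0)^\top I-\dot I^\top(\Gamma_1-\Gamma_0)V-\dot I^\top(B_0-B_1)V_s,$$ with $k_d>0$, $k_i>0$ and new input $\mu\in\mathbb{R}$.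 Then: (a) the closed-loop system defines a passive map $\mu\mapsto\dot u$; (b) if $\mu=0$ and any of (i) $R>0$ and $G>0$; (ii) $R>0$ and $\Gamma(u)$ has full column rank; (iii) $G>0$ and $\Gamma(u)^\top$ has full column rank holds, then the solution of the closed-loop system asymptotically converges to the set $\{(I,V,\dot I,\dot V,u):\dot V=0,\dot I=0,\dot u=0,u=\bar u\}$; (c) if, in addition to one of the conditions in (b) (with $\mu=0$), the matrix $\mathcal{A}=\begin{bmatrix}R&\Gamma(\bar u)\\\Gamma(\bar u)^\top&-G\end{bmatrix}$ has full rank, then the solution of the closed-loop system asymptotically converges to the desired operating point $(\bar I,V^\star,0,0,\bar u)$, which is unique.
   Context: $I\in\mathbb{R}^\sigma$, $V\in\mathbb{R}^\rho$, duty cycle $u\in[0,1]$, constant source $V_s\in\mathbb{R}^m$; $\Gamma_0,\Gamma_1\in\mathbb{R}^{\sigma\times\rho}$, $B_0,B_1\in\mathbb{R}^{\sigma\times m}$ constant. A map $\mu\mapsto z$ is passive if there is a storage function $S\ge0$ of the closed-loop state with $\dot S\le\mu z$ along trajectories. *)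

(* Defs.v *)
From HB Require Import structures.
From mathcomp Require Import all_boot all_order all_algebra.
From mathcomp Require Import all_classical all_reals all_analysis.
Set Implicit Arguments. Unset Strict Implicit. Unset Printing Implicit Defensive.
Import Order.TTheory GRing.Theory Num.Theory.
Import numFieldNormedType.Exports.
Local Open Scope ring_scope.

Section Defs.
Variable R : realType.

Definition posdef n (A : 'M[R]_n) : Prop :=
  A^T = A /\ forall x : 'cV[R]_n, x != 0 -> 0 < (x^T *m A *m x) 0 0.
Definition possemidef n (A : 'M[R]_n) : Prop :=
  A^T = A /\ forall x : 'cV[R]_n, 0 <= (x^T *m A *m x) 0 0.

Definition Gam s r (G0 G1 : 'M[R]_(s, r)) (w : R) : 'M[R]_(s, r) :=
  w *: G1 + (1 - w) *: G0.
Definition Bu s m (B0 B1 : 'M[R]_(s, m)) (w : R) : 'M[R]_(s, m) :=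
  w *: B1 + (1 - w) *: B0.

Definition yout s r m (G0 G1 : 'M[R]_(s, r)) (B0 B1 : 'M[R]_(s, m))
  (Vs : 'cV[R]_m) (I dI : 'cV[R]_s) (V dV : 'cV[R]_r) : R :=
  (dV^T *m (G1 - G0)^T *m I) 0 0 - (dI^T *m (G1 - G0) *m V) 0 0
  - (dI^T *m (B0 - B1) *m Vs) 0 0.

Definition cl_solution s r m (L Rm : 'M[R]_s) (C Gm : 'M[R]_r)
  (G0 G1 : 'M[R]_(s, r)) (B0 B1 : 'M[R]_(s, m)) (Vs : 'cV[R]_m)
  (kd ki ubar : R) (mu : R -> R)
  (I : R -> 'cV[R]_s) (V : R -> 'cV[R]_r) (u : R -> R) : Prop :=
  forall t : R, 0 < t ->
  [/\ derivable I t 1, derivable V t 1, derivable (derive1 I) t 1,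
      derivable (derive1 V) t 1 & derivable u t 1] /\
  0 <= u t <= 1 /\
  [/\
      - (L *m (derive1 I) t) = Rm *m I t + Gam G0 G1 (u t) *m V t
                         - Bu B0 B1 (u t) *m Vs,
      C *m (derive1 V) t = (Gam G0 G1 (u t))^T *m I t - Gm *m V t,
      - (L *m (derive1n 2 I) t) = Rm *m (derive1 I) t + Gam G0 G1 (u t) *m (derive1 V) t
          + (derive1 u) t *: ((G1 - G0) *m V t - (B1 - B0) *m Vs),
      C *m (derive1n 2 V) t = (Gam G0 G1 (u t))^T *m (derive1 I) t
          + (derive1 u) t *: ((G1 - G0)^T *m I t) - Gm *m (derive1 V) t &
      (derive1 u) t = kd^-1 * (mu t - ki * (u t - ubar)
                  - yout G0 G1 B0 B1 Vs (I t) ((derive1 I) t) (V t) ((derive1 V) t))].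

End Defs.

(* Main.v *)
Require Import Defs.
From HB Require Import structures.
From mathcomp Require Import all_boot all_order all_algebra.
From mathcomp Require Import all_classical all_reals all_analysis.
From mathcomp Require Import ring lra.
Import Order.TTheory GRing.Theory Num.Theory.
Import numFieldNormedType.Exports.
Local Open Scope classical_set_scope.
Local Open Scope ring_scope.

(** The incremental energy
      [S = (dI^T L dI + dV^T C dV + ki (u - ubar)^2) / 2]
    satisfies [S' = mu * du - D] with
    [D = dI^T R dI + dV^T G dV + kd du^2 >= 0], which is (a).  For [mu = 0],
    [S] decreases, so [dI] and [dV] are bounded; under each condition of (b)
    the matrix [[R, Gam(u)], [-Gam(u)^T, G]] has an inverse bounded uniformly
    in [u] in [[0, 1]], so the circuit equations bound [I] and [V] too, and
    then every signal has a bounded derivative.  Barbalat's lemma, applied to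
    [S], gives [D -> 0]; applied again to whichever of [dI], [dV] is damped, it
    gives that the second derivative vanishes, and the extended dynamics then
    force the other current or voltage derivative to [0].  Finally [u -> ubar]
    by the control law, and (c) follows by inverting the equilibrium
    equations. *)

(** * Entrywise maximum norm of matrices *)

Section MatrixNorm.
Context {R : realType}.

Lemma entry0 p q i j : (0 : 'M[R]_(p, q)) i j = 0.
Proof. by rewrite mxE. Qed.

Lemma entryN p q (A : 'M[R]_(p, q)) i j : (- A) i j = - A i j.
Proof. by rewrite mxE. Qed.

Lemma entryD m n (A B : 'M[R]_(m, n)) i j : (A + B) i j = A i j + B i j.
Proof. by rewrite mxE. Qed.

Lemma entryZ m n k (A : 'M[R]_(m, n)) i j : (k *: A) i j = k * A i j.
Proof. by rewrite mxE. Qed.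

Lemma mxnorm_ge_entry m n (A : 'M[R]_(m, n)) i j : `|A i j| <= `|A|.
Proof. by rewrite [leRHS]/Num.Def.normr /= mx_normrE; exact: (le_bigmax _ _ (i, j)). Qed.

Lemma mxnorm_le m n (A : 'M[R]_(m, n)) (K : R) :
  0 <= K -> (forall i j, `|A i j| <= K) -> `|A| <= K.
Proof.
by move=> K0 AK; rewrite [leLHS]/Num.Def.normr /= mx_normrE; apply: bigmax_le => // -[i j] _; apply: AK.
Qed.

(** The norm is the largest absolute entry, which is not submultiplicative; the factor [n%:R] counts
    the terms of one row-by-column sum. *)
Lemma mxnorm_mul m n p (A : 'M[R]_(m, n)) (B : 'M[R]_(n, p)) :
  `|A *m B| <= n%:R * (`|A| * `|B|).
Proof.
apply: mxnorm_le => [|i j]; first by rewrite !mulr_ge0.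
rewrite mxE (le_trans (ler_norm_sum _ _ _))//.
rewrite mulr_natl -[X in _ *+ X]card_ord -sumr_const ler_sum// => k _.
by rewrite normrM ler_pM// mxnorm_ge_entry.
Qed.

Lemma mxnorm_tr m n (A : 'M[R]_(m, n)) : `|A^T| = `|A|.
Proof.
by apply/eqP; rewrite eq_le; apply/andP; split; apply: mxnorm_le => // i j;
  [rewrite mxE | rewrite -[A]trmxK mxE trmxK]; exact: mxnorm_ge_entry.
Qed.

End MatrixNorm.

(** * Differentiation rules for matrix-valued functions of time *)

Section MatrixDerivative.
Context {R : realType}.

Lemma is_derive_derive1 {V : normedModType R} (f : R -> V) (t : R) :
  derivable f t 1 -> is_derive t 1 f (derive1 f t).
Proof. by rewrite derive1E => /derivableP. Qed.

Lemma is_derive_sqr (f : R -> R) (df t : R) :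
  is_derive t 1 f df -> is_derive t 1 (fun x => f x ^+ 2) (2 * f t * df).
Proof.
move=> fd; rewrite (_ : (fun x => _) = f * f).
  apply: (is_derive_eq (is_deriveM fd fd)).
  by rewrite /GRing.scale /=; ring.
by apply/funext => x; rewrite expr2.
Qed.

Lemma is_derive_mull (c : R) (f : R -> R) (df t : R) :
  is_derive t 1 f df -> is_derive t 1 (fun x => c * f x) (c * df).
Proof. exact: is_deriveZ. Qed.

Lemma is_derive_mx m n (M : R -> 'M[R]_(m, n)) (dM : 'M[R]_(m, n)) (t : R) :
  (forall i j, is_derive t 1 (fun x => M x i j) (dM i j)) -> is_derive t 1 M dM.
Proof.
move=> Md; have Mt : derivable M t 1 by apply/derivable_mxP => i j; case: (Md i j).
by split => //; rewrite derive_mx//; apply/matrixP => i j; rewrite mxE derive_val.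
Qed.

Lemma is_derive_entry m n (M : R -> 'M[R]_(m, n)) (dM : 'M[R]_(m, n)) (t : R) i j :
  is_derive t 1 M dM -> is_derive t 1 (fun x => M x i j) (dM i j).
Proof.
case=> Mt <-; split; first by have /derivable_mxP := Mt.
by rewrite derive_mx// mxE.
Qed.

Lemma is_derive_mulmx m n p (M : R -> 'M[R]_(m, n)) (N : R -> 'M[R]_(n, p))
    (dM : 'M[R]_(m, n)) (dN : 'M[R]_(n, p)) (t : R) :
  is_derive t 1 M dM -> is_derive t 1 N dN ->
  is_derive t 1 (fun x => M x *m N x) (dM *m N t + M t *m dN).
Proof.
move=> Md Nd; apply: is_derive_mx => i j.
rewrite (_ : (fun x => _) = \sum_(k < n) ((fun x => M x i k) * (fun x => N x k j))); last first.
  by apply/funext => x; rewrite mxE fct_sumE; apply: eq_bigr.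
apply: is_derive_eq.
  apply: is_derive_sum => k; apply: is_deriveM; exact: is_derive_entry.
rewrite !mxE -big_split /=; apply: eq_bigr => k _.
by rewrite /GRing.scale /=; ring.
Qed.

Lemma is_derive_trmx m n (M : R -> 'M[R]_(m, n)) (dM : 'M[R]_(m, n)) (t : R) :
  is_derive t 1 M dM -> is_derive t 1 (fun x => (M x)^T) dM^T.
Proof.
move=> Md; apply: is_derive_mx => i j; rewrite mxE.
rewrite (_ : (fun x => _) = (fun x => M x j i)); first exact: is_derive_entry.
by apply/funext => x; rewrite mxE.
Qed.

Lemma is_derive_scalemx m n (k : R -> R) (M : R -> 'M[R]_(m, n)) (dk : R)
    (dM : 'M[R]_(m, n)) (t : R) :
  is_derive t 1 k dk -> is_derive t 1 M dM ->
  is_derive t 1 (fun x => k x *: M x) (dk *: M t + k t *: dM).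
Proof.
move=> kd Md; apply: is_derive_mx => i j; rewrite !mxE.
rewrite (_ : (fun x => _) = k * (fun x => M x i j)); last first.
  by apply/funext => x; rewrite mxE.
apply: is_derive_eq; first by apply: is_deriveM; exact: is_derive_entry.
by rewrite /GRing.scale /=; ring.
Qed.

(** The product rule yields two terms that are transposes of each other; symmetry of [A] merges them
    into a single doubled one. *)
Lemma is_derive_quadform n (A : 'M[R]_n) (x : R -> 'cV[R]_n) (dx : 'cV[R]_n) (t : R) :
  A^T = A -> is_derive t 1 x dx ->
  is_derive t 1 (fun z => ((x z)^T *m A *m x z) 0 0) (2 * ((x t)^T *m A *m dx) 0 0).
Proof.
move=> As xd.
have xA : is_derive t 1 (fun z => (x z)^T *m A) (dx^T *m A).
  apply: is_derive_eq.
    by apply: is_derive_mulmx; exact: is_derive_trmx.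
  by rewrite mulmx0 addr0.
apply: is_derive_eq; first by apply: is_derive_entry; apply: is_derive_mulmx xA xd.
rewrite mxE mulr_natl mulr2n; congr (_ + _).
by rewrite -[in LHS](trmxK (dx^T *m A *m x t)) mxE !trmx_mul trmxK As mulmxA.
Qed.

End MatrixDerivative.

(** * Quadratic forms and invertibility *)

Section PsdForms.

Context {R : realType}.

(** A 1-by-1 matrix equals its transpose. *)
Lemma bilin_trmx m n (x : 'cV[R]_m) (A : 'M[R]_(m, n)) (y : 'cV[R]_n) :
  (x^T *m A *m y) 0 0 = (y^T *m A^T *m x) 0 0.
Proof. by rewrite -(trmxK (x^T *m A *m y)) mxE !trmx_mul trmxK mulmxA. Qed.

(* Expands [q(x - b / (a + 1) e_i) >= 0] with [a = A i i] and [b = (A x) i],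
   a choice of scalar that also covers [a = 0]. *)
Lemma possemidef_entry_sqr n (A : 'M[R]_n) (x : 'cV[R]_n) i :
  possemidef A -> ((A *m x) i 0) ^+ 2 <= (A i i + 1) * (x^T *m A *m x) 0 0.
Proof.
case=> As Ap; set q := (_ *m x) 0 0; set b := (A *m x) i 0; set a := A i i.
have ea : ((delta_mx i 0 : 'cV[R]_n)^T *m A *m (delta_mx i 0 : 'cV[R]_n)) 0 0 = a.
  by rewrite trmx_delta -rowE -colE !mxE.
have eb : ((delta_mx i 0 : 'cV[R]_n)^T *m A *m x) 0 0 = b.
  by rewrite trmx_delta -mulmxA -rowE mxE.
have a0 : 0 <= a by rewrite -ea; apply: Ap.
have key l : 0 <= q + 2 * l * b + l ^+ 2 * a.
  have := Ap (x + l *: delta_mx i 0).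
  rewrite [(_ + _)^T]linearD /= [(_ *: _)^T]linearZ /= !(mulmxDl, mulmxDr) -!(scalemxAl, scalemxAr).
  rewrite !entryD !entryZ -/q ea eb.
  by rewrite bilin_trmx As eb; lra.
have := key (- (b / (a + 1))).
have a1 : 0 < a + 1 by lra.
(* With [b = c (a + 1)] the division disappears: [key] becomes [q >= c^2 (a + 2)], which dominates
   the required [c^2 (a + 1)]. *)
set c := b / (a + 1); have -> : b = c * (a + 1) by rewrite divfK// gt_eqF.
clearbody c q a => h; nra.
Qed.

(** A singular [A] gives no control of [x] by its form, but it does give control of [A *m x], which
    is all that a semi-definite damping matrix can provide. *)
Lemma possemidef_bound n (A : 'M[R]_n) : possemidef A ->
  exists K, forall x : 'cV[R]_n, `|A *m x| ^+ 2 <= K * (x^T *m A *m x) 0 0.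
Proof.
move=> Ap; exists (\sum_i (`|A i i| + 1)) => x.
have q0 := Ap.2 x; set q := (_ *m x) 0 0 in q0 *.
have S0 : 0 <= \sum_i (`|A i i| + 1) by apply: sumr_ge0 => i _; rewrite addr_ge0.
rewrite -[leRHS]sqr_sqrtr ?mulr_ge0// ler_sqr ?nnegrE ?sqrtr_ge0//.
apply: mxnorm_le => [|i j]; rewrite ?sqrtr_ge0// ord1 -sqrtr_sqr ler_sqrt ?mulr_ge0//.
apply: le_trans (possemidef_entry_sqr _ _ _ i Ap) _; rewrite ler_wpM2r//.
rewrite (bigD1 i)//= (@le_trans _ _ (`|A i i| + 1)) ?lerD2r ?ler_norm//.
by rewrite lerDl sumr_ge0// => k _; rewrite addr_ge0.
Qed.

Lemma posdef_possemidef n (A : 'M[R]_n) : posdef A -> possemidef A.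
Proof.
case=> As Ap; split=> // x; have [->|/Ap/ltW//] := eqVneq x 0.
by rewrite mulmx0 mxE.
Qed.

(** [kermx] describes row vectors killed from the left, so the argument runs on the transpose. *)
Lemma unitmx_inj n (A : 'M[R]_n) :
  (forall x : 'cV[R]_n, A *m x = 0 -> x = 0) -> A \in unitmx.
Proof.
move=> inj; rewrite -unitmx_tr -row_free_unit -kermx_eq0; apply/rowV0P => v /sub_kermxP vA.
by apply/trmx_inj; rewrite trmx0; apply: inj; rewrite -[A]trmxK -trmx_mul vA trmx0.
Qed.

Lemma posdef_unit n (A : 'M[R]_n) : posdef A -> A \in unitmx.
Proof.
case=> _ Ap; apply: unitmx_inj => x Ax0; apply/eqP; apply/negPn/negP => /Ap.
by rewrite -mulmxA Ax0 mulmx0 mxE ltxx.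
Qed.

End PsdForms.

(** * Calculus of signals that are bounded near infinity or tend to zero *)

Section BoundedAtInfinity.
Context {R : realType}.

(** Boundedness is asked only near [+oo]: [cl_solution] constrains the signals at positive times
    only, and limits at infinity see nothing else. *)
Definition bnd {V : normedModType R} (f : R -> V) :=
  exists K, \forall t \near +oo, `|f t| <= K.

Lemma near_gt0 (P : R -> Prop) : (forall t, 0 < t -> P t) -> \forall t \near +oo, P t.
Proof. by move=> P0; near=> t; apply: P0. Unshelve. all: by end_near. Qed.

Lemma bnd_near {V : normedModType R} (f g : R -> V) :
  (\forall t \near +oo, f t = g t) -> bnd f -> bnd g.
Proof. by move=> fg [K fK]; exists K; near=> t; rewrite -(near fg t)//; near: t. Unshelve. all: by end_near. Qed.

Lemma bnd_cst {V : normedModType R} (v : V) : bnd (fun=> v).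
Proof. by exists `|v|; near=> t. Unshelve. all: by end_near. Qed.

Lemma bndD {V : normedModType R} (f g : R -> V) :
  bnd f -> bnd g -> bnd (fun t => f t + g t).
Proof.
move=> [K fK] [M gM]; exists (K + M); near=> t.
by rewrite (le_trans (ler_normD _ _))// lerD//; near: t.
Unshelve. all: by end_near. Qed.

Lemma bndN {V : normedModType R} (f : R -> V) : bnd f -> bnd (fun t => - f t).
Proof. by move=> [K fK]; exists K; near=> t; rewrite normrN; near: t. Unshelve. all: by end_near. Qed.

Lemma bndB {V : normedModType R} (f g : R -> V) :
  bnd f -> bnd g -> bnd (fun t => f t - g t).
Proof. by move=> bf bg; apply: bndD => //; apply: bndN. Qed.

Lemma bndZ {V : normedModType R} (k : R -> R) (f : R -> V) :
  bnd k -> bnd f -> bnd (fun t => k t *: f t).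
Proof.
move=> [K fK] [M gM]; exists (K * M); near=> t.
by rewrite normrZ ler_pM//; near: t.
Unshelve. all: by end_near. Qed.

Lemma bndM (k f : R -> R) : bnd k -> bnd f -> bnd (fun t => k t * f t).
Proof. exact: bndZ. Qed.

Lemma bnd_mulmx m n p (f : R -> 'M[R]_(m, n)) (g : R -> 'M[R]_(n, p)) :
  bnd f -> bnd g -> bnd (fun t => f t *m g t).
Proof.
move=> [K fK] [M gM]; exists (n%:R * (K * M)); near=> t.
rewrite (le_trans (mxnorm_mul _ _ _ _ _))// ler_wpM2l// ler_pM//; near: t.
all: by [].
Unshelve. all: by end_near. Qed.

Lemma bnd_trmx m n (f : R -> 'M[R]_(m, n)) : bnd f -> bnd (fun t => (f t)^T).
Proof.
by move=> [K fK]; exists K; near=> t; rewrite mxnorm_tr; near: t.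
Unshelve. all: by end_near. Qed.

Lemma bnd_entry m n (f : R -> 'M[R]_(m, n)) i j : bnd f -> bnd (fun t => f t i j).
Proof.
move=> [K fK]; exists K; near=> t; apply: le_trans (mxnorm_ge_entry _ _ _ _ _) _.
by near: t.
Unshelve. all: by end_near. Qed.

Lemma bnd_col_mx m n p (f : R -> 'M[R]_(m, p)) (g : R -> 'M[R]_(n, p)) :
  bnd f -> bnd g -> bnd (fun t => col_mx (f t) (g t)).
Proof.
move=> [K fK] [M gM]; exists (K + M); near=> t.
have fKt : `|f t| <= K by near: t.
have gMt : `|g t| <= M by near: t.
have K0 : 0 <= K by exact: le_trans fKt.
have M0 : 0 <= M by exact: le_trans gMt.
apply: mxnorm_le => [|i j]; first exact: addr_ge0.
rewrite mxE; case: splitP => k _; apply: le_trans (mxnorm_ge_entry _ _ _ _ _) _.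
  by rewrite (le_trans fKt)// lerDl.
by rewrite (le_trans gMt)// lerDr.
Unshelve. all: by end_near. Qed.

Lemma bnd_usubmx m n p (f : R -> 'M[R]_(m + n, p)) : bnd f -> bnd (fun t => usubmx (f t)).
Proof.
move=> [K fK]; exists K; near=> t; have fKt : `|f t| <= K by near: t.
apply: mxnorm_le => [|i j]; first exact: le_trans fKt.
by rewrite mxE (le_trans (mxnorm_ge_entry _ _ _ _ _)).
Unshelve. all: by end_near. Qed.

Lemma bnd_dsubmx m n p (f : R -> 'M[R]_(m + n, p)) : bnd f -> bnd (fun t => dsubmx (f t)).
Proof.
move=> [K fK]; exists K; near=> t; have fKt : `|f t| <= K by near: t.
apply: mxnorm_le => [|i j]; first exact: le_trans fKt.
by rewrite mxE (le_trans (mxnorm_ge_entry _ _ _ _ _)).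
Unshelve. all: by end_near. Qed.

Lemma cvg0_mulmx m n p (f : R -> 'M[R]_(m, n)) (g : R -> 'M[R]_(n, p)) :
  bnd f -> g t @[t --> +oo] --> (0 : 'M[R]_(n, p)) ->
  (f t *m g t) @[t --> +oo] --> (0 : 'M[R]_(m, p)).
Proof.
move=> [K fK] /norm_cvg0P g0; apply/norm_cvg0P.
have h0 : (n%:R * (K * `|g t|)) @[t --> +oo] --> (0 : R).
  rewrite -(mulr0 (n%:R : R)) -[X in _ * X](mulr0 K).
  by apply: cvgM; [exact: cvg_cst | apply: cvgM; [exact: cvg_cst |]].
apply: (squeeze_cvgr _ (cvg_cst 0) h0); near=> t.
rewrite normr_ge0/= (le_trans (mxnorm_mul _ _ _ _ _))// ler_wpM2l// ler_wpM2r//.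
by near: t.
Unshelve. all: by end_near. Qed.

Lemma cvg0_scale m n (k : R -> R) (f : R -> 'M[R]_(m, n)) :
  k t @[t --> +oo] --> 0 -> bnd f -> (k t *: f t) @[t --> +oo] --> (0 : 'M[R]_(m, n)).
Proof.
move=> /cvg_norm; rewrite normr0 => k0 [K fK]; apply/norm_cvg0P.
have h0 : (`|k t| * K) @[t --> +oo] --> (0 : R).
  by rewrite -(mul0r K); apply: cvgM k0 _; exact: cvg_cst.
apply: (squeeze_cvgr _ (cvg_cst 0) h0); near=> t.
rewrite normr_ge0/= normrZ ler_wpM2l//.
by near: t.
Unshelve. all: by end_near. Qed.

Lemma cvg_entry m n (f : R -> 'M[R]_(m, n)) (l : 'M[R]_(m, n)) i j :
  f t @[t --> +oo] --> l -> f t i j @[t --> +oo] --> l i j.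
Proof. by move=> fl; exact: (cvg_comp _ _ fl (@coord_continuous R m n i j l)). Qed.

Lemma cvg0_mxP m n (f : R -> 'M[R]_(m, n)) :
  (forall i j, f t i j @[t --> +oo] --> 0) -> f t @[t --> +oo] --> (0 : 'M[R]_(m, n)).
Proof.
move=> f0; apply/cvgr0Pnorm_le => e e0; near=> t.
apply: mxnorm_le => [|i j]; first exact: ltW.
move: i j; near: t.
apply: filter_forall => i; apply: filter_forall => j.
exact: cvgr0_norm_le.
Unshelve. all: by end_near. Qed.

Lemma bnd_le {V W : normedModType R} (f : R -> V) (g : R -> W) :
  (\forall t \near +oo, `|f t| <= `|g t|) -> bnd g -> bnd f.
Proof.
move=> fg [K gK]; exists K; near=> t.
by apply: (@le_trans _ _ `|g t|); near: t.
Unshelve. all: by end_near. Qed.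

Lemma cvg_bnd {V : normedModType R} (f : R -> V) (l : V) :
  f t @[t --> +oo] --> l -> bnd f.
Proof.
move=> fl; exists (`|l| + 1).
have l1 : `|l| < `|l| + 1 by rewrite ltrDl.
exact: cvgr_norm_le l1.
Qed.

Lemma cvg0_sqr {V : normedModType R} (f : R -> V) :
  `|f t| ^+ 2 @[t --> +oo] --> (0 : R) -> f t @[t --> +oo] --> (0 : V).
Proof.
move=> f0; apply/cvgr0Pnorm_le => e e0; near=> t.
rewrite -ler_sqr ?nnegrE ?(ltW e0)//.
rewrite -[leLHS]ger0_norm ?exprn_ge0//; near: t.
by apply: cvgr0_norm_le => //; rewrite exprn_gt0.
Unshelve. all: by end_near. Qed.

Lemma cvg0_le (f g : R -> R) : (\forall t \near +oo, 0 <= f t <= g t) ->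
  g t @[t --> +oo] --> (0 : R) -> f t @[t --> +oo] --> (0 : R).
Proof. by move=> fg g0; apply: (squeeze_cvgr fg (cvg_cst 0) g0). Qed.

Lemma possemidef_bnd n (A : 'M[R]_n) (x : R -> 'cV[R]_n) : possemidef A ->
  bnd (fun t => ((x t)^T *m A *m x t) 0 0) -> bnd (fun t => A *m x t).
Proof.
move=> Ap [M qM]; have [K AK] := possemidef_bound _ _ Ap.
(* [1 + c] bounds every [y] with [y ^+ 2 <= c], without a square root; the sign of [K] is unknown,
   hence its absolute value. *)
exists (1 + `|K| * M); near=> t.
have qt : ((x t)^T *m A *m x t) 0 0 <= M by apply: le_trans (ler_norm _) _; near: t.
have := AK (x t); have := Ap.2 (x t) => q0 Ax.
have {}Ax : `|A *m x t| ^+ 2 <= `|K| * M.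
  by rewrite (le_trans Ax)// (le_trans (ler_wpM2r q0 (ler_norm K)))// ler_wpM2l.
nra.
Unshelve. all: by end_near. Qed.

Lemma possemidef_cvg0 n (A : 'M[R]_n) (x : R -> 'cV[R]_n) : possemidef A ->
  ((x t)^T *m A *m x t) 0 0 @[t --> +oo] --> (0 : R) ->
  (A *m x t) @[t --> +oo] --> (0 : 'cV[R]_n).
Proof.
move=> Ap q0; have [K AK] := possemidef_bound _ _ Ap.
apply: cvg0_sqr; apply: (@cvg0_le _ (fun t => K * ((x t)^T *m A *m x t) 0 0)).
  by near=> t; rewrite exprn_ge0//= AK.
by rewrite -(mulr0 K); apply: cvgM => //; exact: cvg_cst.
Unshelve. all: by end_near. Qed.

Lemma cvg0D {V : normedModType R} (f g : R -> V) :
  f t @[t --> +oo] --> (0 : V) -> g t @[t --> +oo] --> (0 : V) ->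
  f t + g t @[t --> +oo] --> (0 : V).
Proof. by move=> f0 g0; rewrite -(addr0 (0 : V)); exact: cvgD. Qed.

Lemma cvg0N {V : normedModType R} (f : R -> V) :
  f t @[t --> +oo] --> (0 : V) -> - f t @[t --> +oo] --> (0 : V).
Proof. by move=> f0; rewrite -oppr0; exact: cvgN. Qed.

Lemma cvg0B {V : normedModType R} (f g : R -> V) :
  f t @[t --> +oo] --> (0 : V) -> g t @[t --> +oo] --> (0 : V) ->
  f t - g t @[t --> +oo] --> (0 : V).
Proof. by move=> f0 g0; apply: cvg0D => //; apply: cvg0N. Qed.

Lemma cvg0Mr (c : R) (f : R -> R) :
  f t @[t --> +oo] --> (0 : R) -> c * f t @[t --> +oo] --> (0 : R).
Proof. by move=> f0; rewrite -(mulr0 c); apply: cvgM => //; exact: cvg_cst. Qed.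

Lemma cvg0_entry m n (f : R -> 'M[R]_(m, n)) i j :
  f t @[t --> +oo] --> (0 : 'M[R]_(m, n)) -> f t i j @[t --> +oo] --> (0 : R).
Proof. by move=> /(cvg_entry _ _ _ _ i j); rewrite mxE. Qed.

Lemma cvg0_col_mx m n p (f : R -> 'M[R]_(m, p)) (g : R -> 'M[R]_(n, p)) :
  f t @[t --> +oo] --> (0 : 'M[R]_(m, p)) -> g t @[t --> +oo] --> (0 : 'M[R]_(n, p)) ->
  col_mx (f t) (g t) @[t --> +oo] --> (0 : 'M[R]_(m + n, p)).
Proof.
move=> f0 g0; apply: cvg0_mxP => i j; case: (split_ordP i) => k ->.
- by under eq_fun do rewrite col_mxEu; exact: cvg0_entry.
- by under eq_fun do rewrite col_mxEd; exact: cvg0_entry.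
Qed.

Lemma cvg0_usubmx m n p (f : R -> 'M[R]_(m + n, p)) :
  f t @[t --> +oo] --> (0 : 'M[R]_(m + n, p)) ->
  usubmx (f t) @[t --> +oo] --> (0 : 'M[R]_(m, p)).
Proof.
by move=> f0; apply: cvg0_mxP => i j; under eq_fun do rewrite mxE; exact: cvg0_entry.
Qed.

Lemma cvg0_dsubmx m n p (f : R -> 'M[R]_(m + n, p)) :
  f t @[t --> +oo] --> (0 : 'M[R]_(m + n, p)) ->
  dsubmx (f t) @[t --> +oo] --> (0 : 'M[R]_(n, p)).
Proof.
by move=> f0; apply: cvg0_mxP => i j; under eq_fun do rewrite mxE; exact: cvg0_entry.
Qed.

Lemma cvg_near {V : normedModType R} (f g : R -> V) (l : V) :
  (\forall t \near +oo, f t = g t) -> f t @[t --> +oo] --> l -> g t @[t --> +oo] --> l.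
Proof. by move=> fg; apply: cvg_trans; exact: near_eq_cvg. Qed.

(** Monotone convergence for [- F]. Since [F] is differentiable only at positive times, its argument
    is clamped to [Num.max t 1], which gives a function monotone on the whole line that agrees with
    [- F] near [+oo]. *)
Lemma nonincreasing_cvg (F f : R -> R) :
  (forall t : R, 0 < t -> is_derive t 1 F (f t)) -> (forall t, 0 < t -> f t <= 0) ->
  (forall t, 0 <= F t) -> exists l, F t @[t --> +oo] --> (l : R).
Proof.
move=> Fd f0 F0; pose g t := - F (Num.max t 1).
have gnd : nondecreasing_fun g.
  move=> x y xy; rewrite /g lerN2.
  have : Num.max x 1 <= Num.max y 1.
    by rewrite ge_max !le_max xy lexx orbT.
  have x1 : 0 < Num.max x 1 by rewrite lt_max ltr01 orbT.
  move: (Num.max x 1) (Num.max y 1) x1 => a b a0 ab.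
  have [| |c cab Fab] := @MVT_segment _ F f a b ab.
  - move=> z; rewrite in_itv/= => /andP[az _]; apply: Fd; exact: lt_trans az.
  - apply/continuous_in_subspaceT => z /set_mem/=; rewrite in_itv/= => /andP[az _].
    apply/differentiable_continuous/derivable1_diffP.
    by case: (Fd z (lt_le_trans a0 az)).
  - rewrite -subr_le0 Fab mulr_le0_ge0 ?subr_ge0//; apply: f0.
    by move: cab; rewrite in_itv/= => /andP[ac _]; exact: lt_le_trans ac.
have gub : has_ubound (range g) by exists 0 => _ [t _ <-]; rewrite oppr_le0.
exists (- sup (range g)).
apply: cvg_trans (cvgN (nondecreasing_cvgr gnd gub)).
apply: near_eq_cvg; near=> t; rewrite /g /= opprK max_l//.
Unshelve. all: by end_near. Qed.

End BoundedAtInfinity.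

(** * Barbalat's lemma and signals with a bounded derivative *)

Section BoundedC1.
Context {R : realType}.

(** The regularity under which Barbalat's lemma is used: the derivative bound supplies uniform
    continuity, and the class is closed under the sums and products met in the dynamics. *)
Definition bndC1 {V : normedModType R} (f : R -> V) :=
  bnd f /\ exists2 df : R -> V, bnd df & \forall t \near +oo, is_derive (t : R) 1 f (df t).

(* Both increments of [F] and [f] over [t, t + h] are estimated by the mean
   value theorem: [h |f t| <= |F (t + h) - F t| + K h^2]. *)
Lemma barbalat (F f : R -> R) (l : R) :
  F t @[t --> +oo] --> l -> (\forall t \near +oo, is_derive (t : R) 1 F (f t)) ->
  bndC1 f -> f t @[t --> +oo] --> 0.
Proof.
move=> Fl [M1 [_ Fd]] [_ [df [K [M2 [_ dfK]]] [M3 [_ fd]]]].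
apply/cvgr0Pnorm_le => e e0.
(* Small enough that [f] varies by at most [e / 2] over the window; the [+ 1] keeps the denominator
   positive. *)
pose h := e / 2 / (`|K| + 1).
have K1 : 0 < `|K| + 1 by rewrite ltr_wpDl.
have h0 : 0 < h by rewrite !divr_gt0.
have hK : K * h <= e / 2.
  rewrite -[leRHS](divfK (lt0r_neq0 K1)) -/h mulrC ler_wpM2l ?ltW//.
  by rewrite (le_lt_trans (ler_norm _))// ltrDl.
(* Half of the increment allowed for [F]: both [F t] and [F (t + h)] will lie this close to [l],
   which forces [|f c| <= e / 2]. *)
have eh : 0 < e / 2 * h / 2 by rewrite !(divr_gt0, mulr_gt0).
have [M4 [_ FM]] := (cvgrPdist_le _ _).1 Fl _ eh.
near=> t.
have t1 : M1 < t by near: t; apply: nbhs_pinfty_gt; rewrite num_real.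
have t2 : M2 < t by near: t; apply: nbhs_pinfty_gt; rewrite num_real.
have t3 : M3 < t by near: t; apply: nbhs_pinfty_gt; rewrite num_real.
have t4 : M4 < t by near: t; apply: nbhs_pinfty_gt; rewrite num_real.
have th : t < t + h by rewrite ltrDl.
have gt M x : M < t -> x \in `[t, t + h] -> M < x.
  by move=> Mt; rewrite in_itv/= => /andP[tx _]; exact: lt_le_trans Mt tx.
have incr (g dg : R -> R) (M : R) s : M < t -> (forall x, M < x -> is_derive x 1 g (dg x)) ->
    t < s -> s <= t + h -> exists2 c, c \in `[t, t + h] & g s - g t = dg c * (s - t).
  move=> Mt gd ts sh.
  have gt' x : x \in `[t, s] -> M < x.
    by rewrite in_itv/= => /andP[tx _]; exact: lt_le_trans Mt tx.
  have [|x xts|c cts ->] := @MVT_segment _ g dg t s (ltW ts).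
  - by move=> x xts; apply/gd/gt'; apply: subset_itv_oo_cc.
  - by apply/continuous_in_subspaceT => y /set_mem/= /gt' /gd gy; apply/differentiable_continuous/derivable1_diffP; case: gy.
  - exists c => //; move: cts; rewrite !in_itv/= => /andP[-> /le_trans]; exact.
have [c ct Fc] := incr F f M1 (t + h) t1 Fd th (lexx _).
have fct : `|f c - f t| <= K * h.
  (* [incr] needs two distinct times, whereas [c] ranges over the closed window. *)
  have [->|ctn] := eqVneq c t.
    rewrite subrr normr0 mulr_ge0 ?(ltW h0)//.
    by apply: le_trans (dfK t t2).
  move: ct; rewrite in_itv/= => /andP[tc cth].
  have tc' : t < c by rewrite lt_neqAle eq_sym ctn.
  have [d dt ->] := incr f df M3 c t3 fd tc' cth.
  rewrite normrM ler_pM//; first by apply: dfK; exact: gt dt.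
  by rewrite ger0_norm ?subr_ge0// lerBlDl.
have Fth : `|f c * h| <= e / 2 * h.
  rewrite (_ : f c * h = (l - F t) - (l - F (t + h))); last first.
    have <- : F (t + h) - F t = f c * h by rewrite Fc; ring.
    by ring.
  rewrite (le_trans (ler_normB _ _))//.
  have := FM t t4; have := FM (t + h) (lt_trans t4 th); lra.
have fc : `|f c| <= e / 2.
  by move: Fth; rewrite normrM (gtr0_norm h0) ler_pM2r.
rewrite -[f t](subKr (f c)) (le_trans (ler_normB _ _))//; lra.
Unshelve. all: by end_near. Qed.

(** Transporting a derivative needs equality on a neighbourhood of each late time, not only at that
    time; half-lines [t > M] are open. *)
Lemma near_infty_near (P : R -> Prop) :
  (\forall t \near +oo, P t) -> \forall t \near +oo, \forall z \near t, P z.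
Proof.
move=> [M [Mr MP]]; exists M; split => // t Mt.
by near=> z; apply: MP; near: z; exact: lt_nbhsr.
Unshelve. all: by end_near. Qed.

Lemma bndC1_near {V : normedModType R} (f g : R -> V) :
  (\forall t \near +oo, f t = g t) -> bndC1 f -> bndC1 g.
Proof.
move=> fg [bf [df bdf fd]]; split; first exact: bnd_near bf.
exists df => //; apply: filterS2 fd (near_infty_near _ fg) => t ftd fgt.
exact: near_eq_is_derive ftd.
Qed.

Lemma bndC1_cst {V : normedModType R} (v : V) : bndC1 (fun=> v).
Proof.
split; first exact: bnd_cst.
by exists (fun=> 0); [exact: bnd_cst | near=> t; exact: is_derive_cst].
Unshelve. all: by end_near. Qed.

Lemma bndC1D {V : normedModType R} (f g : R -> V) :
  bndC1 f -> bndC1 g -> bndC1 (fun t => f t + g t).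
Proof.
move=> [bf [df bdf fd]] [bg [dg bdg gd]]; split; first exact: bndD.
exists (fun t => df t + dg t); first exact: bndD.
by apply: filterS2 fd gd => t; exact: is_deriveD.
Qed.

Lemma bndC1N {V : normedModType R} (f : R -> V) : bndC1 f -> bndC1 (fun t => - f t).
Proof.
move=> [bf [df bdf fd]]; split; first exact: bndN.
exists (fun t => - df t); first exact: bndN.
by apply: filterS fd => t; exact: is_deriveN.
Qed.

Lemma bndC1M (f g : R -> R) : bndC1 f -> bndC1 g -> bndC1 (fun t => f t * g t).
Proof.
move=> [bf [df bdf fd]] [bg [dg bdg gd]]; split; first exact: bndM.
exists (fun t => f t * dg t + g t * df t); first by apply: bndD; exact: bndM.
by apply: filterS2 fd gd => t; exact: is_deriveM.
Qed.

Lemma bndC1_scale m n (k : R -> R) (f : R -> 'M[R]_(m, n)) :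
  bndC1 k -> bndC1 f -> bndC1 (fun t => k t *: f t).
Proof.
move=> [bf [df bdf fd]] [bg [dg bdg gd]]; split; first exact: bndZ.
exists (fun t => df t *: f t + k t *: dg t); first by apply: bndD; exact: bndZ.
by apply: filterS2 fd gd => t; exact: is_derive_scalemx.
Qed.

Lemma bndC1_mulmx m n p (f : R -> 'M[R]_(m, n)) (g : R -> 'M[R]_(n, p)) :
  bndC1 f -> bndC1 g -> bndC1 (fun t => f t *m g t).
Proof.
move=> [bf [df bdf fd]] [bg [dg bdg gd]]; split; first exact: bnd_mulmx.
exists (fun t => df t *m g t + f t *m dg t); first by apply: bndD; exact: bnd_mulmx.
by apply: filterS2 fd gd => t; exact: is_derive_mulmx.
Qed.

Lemma bndC1_trmx m n (f : R -> 'M[R]_(m, n)) : bndC1 f -> bndC1 (fun t => (f t)^T).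
Proof.
move=> [bf [df bdf fd]]; split; first exact: bnd_trmx.
exists (fun t => (df t)^T); first exact: bnd_trmx.
by apply: filterS fd => t; exact: is_derive_trmx.
Qed.

Lemma bndC1_entry m n (f : R -> 'M[R]_(m, n)) i j : bndC1 f -> bndC1 (fun t => f t i j).
Proof.
move=> [bf [df bdf fd]]; split; first exact: bnd_entry.
exists (fun t => df t i j); first exact: bnd_entry.
by apply: filterS fd => t; exact: is_derive_entry.
Qed.

Lemma barbalat_mx m n (F f : R -> 'M[R]_(m, n)) (l : 'M[R]_(m, n)) :
  F t @[t --> +oo] --> l -> (\forall t \near +oo, is_derive (t : R) 1 F (f t)) ->
  bndC1 f -> f t @[t --> +oo] --> (0 : 'M[R]_(m, n)).
Proof.
move=> Fl Fd bf; apply: cvg0_mxP => i j.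
apply: (barbalat (fun t => F t i j) _ (l i j)); first exact: cvg_entry.
  by apply: filterS Fd => t; exact: is_derive_entry.
exact: bndC1_entry.
Qed.

End BoundedC1.

(** * Uniform bound on the inverse of a continuous matrix family over the unit interval *)

Section InverseBound.
Context {R : realType}.

Lemma continuous_bigprod {I : Type} (r : seq I) (f : I -> R -> R) :
  (forall i, continuous (f i)) -> continuous (fun w => \prod_(i <- r) f i w).
Proof.
move=> cf; elim: r => [|i r IHr].
  rewrite (_ : (fun w => _) = cst 1); first exact: cst_continuous.
  by apply/funext => w; rewrite big_nil.
rewrite (_ : (fun w => _) = (fun w => f i w * \prod_(j <- r) f j w)).
  by move=> w; apply: cvgM; [exact: cf | exact: IHr].
by apply/funext => w; rewrite big_cons.
Qed.

Lemma continuous_det n (M : R -> 'M[R]_n) :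
  (forall i j, continuous (fun w => M w i j)) -> continuous (fun w => \det (M w)).
Proof.
move=> cM w; rewrite /determinant.
apply: (@cvg_big _ _ +%R); first exact: add_continuous.
move=> s _; apply: cvgM; first exact: cvg_cst.
by apply: continuous_bigprod => i; exact: cM.
Qed.

(** Cramer's formula and compactness: a continuous majorant of all entries of the inverse attains
    its maximum on [[0, 1]]. *)
Lemma invmx_bound n (M : R -> 'M[R]_n) :
  (forall i j, continuous (fun w => M w i j)) ->
  (forall w, 0 <= w <= 1 -> M w \in unitmx) ->
  exists K, forall w, 0 <= w <= 1 -> `|invmx (M w)| <= K.
Proof.
move=> cM uM.
(* Each entry of the adjugate is one cofactor, so the sum of all absolute cofactors dominates every
   entry and a single scalar function remains to be maximised. *)
pose S w := \sum_(i < n) \sum_(j < n) `|cofactor (M w) j i|.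
pose g w := `|\det (M w)|^-1 * S w.
have cS : continuous S.
  move=> w; apply: (@cvg_big _ _ +%R); first exact: add_continuous.
  move=> i _; apply: (@cvg_big _ _ +%R); first exact: add_continuous.
  move=> j _; apply: cvg_norm; rewrite /cofactor.
  apply: cvgM; first exact: cvg_cst.
  apply: continuous_det => k l.
  rewrite (_ : (fun w => _) = (fun w => M w (lift j k) (lift i l))); first exact: cM.
  by apply/funext => z; rewrite !mxE.
have gc : {within `[0, 1], continuous g}.
  apply/continuous_in_subspaceT => w /set_mem/=; rewrite in_itv/= => w01.
  apply: cvgM; last exact: cS.
  apply: cvgV; last by apply: cvg_norm; exact: continuous_det.
  by rewrite normr_eq0 -unitfE -unitmxE uM.
have [c _ gK] := EVT_max ler01 gc.
exists (g c) => w w01; apply: le_trans (gK w _); last by rewrite in_itv.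
have S0 (i : 'I_n) : 0 <= \sum_(j < n) `|cofactor (M w) j i| by apply: sumr_ge0.
apply: mxnorm_le => [|i j].
  by rewrite mulr_ge0 ?invr_ge0// sumr_ge0.
rewrite /invmx uM// !mxE normrM normfV ler_wpM2l ?invr_ge0//.
rewrite /S (bigD1 i)//= (bigD1 j)//= -addrA lerDl addr_ge0 ?sumr_ge0//.
Qed.

End InverseBound.

(** * Energy balance and circuit matrix of the closed loop *)

Section ClosedLoop.
Context {R : realType} {s r m : nat}.
Context (L Rm : 'M[R]_s) (C Gm : 'M[R]_r) (G0 G1 : 'M[R]_(s, r)).
Context (B0 B1 : 'M[R]_(s, m)) (Vs : 'cV[R]_m) (kd ki ubar : R).
Context (Lpd : posdef L) (Cpd : posdef C) (Rpsd : possemidef Rm) (Gpsd : possemidef Gm).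
Context (kd0 : 0 < kd) (ki0 : 0 < ki).

(** Affine dependence on the duty cycle makes the first-order expansion exact; it is used to compare
    the matrices at [u t] with those at [ubar]. *)
Lemma GamB p q (H0 H1 : 'M[R]_(p, q)) w z :
  Gam H0 H1 w = Gam H0 H1 z + (w - z) *: (H1 - H0).
Proof. by apply/matrixP => i j; rewrite !mxE; ring. Qed.

Lemma BuB p q (H0 H1 : 'M[R]_(p, q)) w z :
  Bu H0 H1 w = Bu H0 H1 z + (w - z) *: (H1 - H0).
Proof. exact: GamB. Qed.

Definition storage (dI : 'cV[R]_s) (dV : 'cV[R]_r) (w : R) : R :=
  2^-1 * ((dI^T *m L *m dI) 0 0 + (dV^T *m C *m dV) 0 0 + ki * (w - ubar) ^+ 2).

Definition dissipation (dI : 'cV[R]_s) (dV : 'cV[R]_r) (v : R) : R :=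
  (dI^T *m Rm *m dI) 0 0 + (dV^T *m Gm *m dV) 0 0 + kd * v ^+ 2.

Lemma storage_ge0 dI dV w : 0 <= storage dI dV w.
Proof.
have [_ Lp] := posdef_possemidef _ _ Lpd; have [_ Cp] := posdef_possemidef _ _ Cpd.
by rewrite /storage mulr_ge0 ?invr_ge0// !addr_ge0// mulr_ge0 ?sqr_ge0 ?ltW.
Qed.

Lemma dissipation_ge0 dI dV v : 0 <= dissipation dI dV v.
Proof.
have [_ Rp] := Rpsd; have [_ Gp] := Gpsd.
by rewrite /dissipation !addr_ge0// mulr_ge0 ?sqr_ge0 ?ltW.
Qed.

(** The interconnection term [dI^T Gam dV] enters the current and voltage balances with opposite
    signs and cancels. What multiplies [du] is then exactly [yout] plus [ki (u - ubar)], which the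
    control law turns into [mu - kd du]. *)
Lemma is_derive_storage (mu : R -> R) (I : R -> 'cV[R]_s) (V : R -> 'cV[R]_r) (u : R -> R) :
  cl_solution L Rm C Gm G0 G1 B0 B1 Vs kd ki ubar mu I V u ->
  forall t : R, 0 < t ->
  is_derive t 1 (fun t => storage (derive1 I t) (derive1 V t) (u t))
    (mu t * derive1 u t - dissipation (derive1 I t) (derive1 V t) (derive1 u t)).
Proof.
move=> sol t t0; have [[_ _ ddI ddV du] [_ [_ _ e3 e4 e5]]] := sol t t0.
have qL := is_derive_quadform _ _ _ _ _ (proj1 Lpd) (derivableP ddI).
have qC := is_derive_quadform _ _ _ _ _ (proj1 Cpd) (derivableP ddV).
have ud : is_derive t 1 (fun t => u t - ubar) (derive1 u t).
  apply: is_derive_eq; first exact: (is_deriveB (derivableP du) (is_derive_cst ubar t 1)).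
  by rewrite subr0 derive1E.
have qu : is_derive t 1 (fun t => ki * (u t - ubar) ^+ 2) (ki * (2 * (u t - ubar) * derive1 u t)).
  exact: is_derive_mull (is_derive_sqr _ _ _ ud).
apply: (is_derive_eq (is_derive_mull 2^-1 _ _ _ (is_deriveD (is_deriveD qL qC) qu))).
rewrite -!derive1E; move: e3 e4; rewrite /derive1n /=.
set dI := derive1 I t; set dV := derive1 V t; set v := derive1 u t in e5 *.
set a := derive1 (derive1 I) t; set b := derive1 (derive1 V) t => e3 e4.
have e3' : L *m a = - (Rm *m dI + Gam G0 G1 (u t) *m dV + v *: ((G1 - G0) *m V t - (B1 - B0) *m Vs)).
  by rewrite -e3 opprK.
have {e3'} ea : (dI^T *m L *m a) 0 0 = - ((dI^T *m Rm *m dI) 0 0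
    + (dI^T *m Gam G0 G1 (u t) *m dV) 0 0
    + v * ((dI^T *m (G1 - G0) *m V t) 0 0 - (dI^T *m (B1 - B0) *m Vs) 0 0)).
  rewrite -mulmxA e3' mulmxN 2!mulmxDr -scalemxAr mulmxBr !mulmxA.
  by rewrite entryN 2!entryD entryZ entryD entryN.
have {e4} eb : (dV^T *m C *m b) 0 0 = (dI^T *m Gam G0 G1 (u t) *m dV) 0 0
    + v * (dV^T *m (G1 - G0)^T *m I t) 0 0 - (dV^T *m Gm *m dV) 0 0.
  rewrite -mulmxA e4 mulmxBr mulmxDr -scalemxAr !mulmxA.
  by rewrite 2!entryD entryN entryZ [X in X + _ - _]bilin_trmx trmxK.
(* The control law solved for the input, so that [mu t] can be eliminated from the claim. *)
have ey : mu t = kd * v + ki * (u t - ubar) + yout G0 G1 B0 B1 Vs (I t) dI (V t) dV.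
  by rewrite e5 mulrA divff ?gt_eqF// mul1r; ring.
move: ey; rewrite /yout -/dI -/dV -(opprB B1 B0) mulmxN mulNmx entryN.
by move=> ->; rewrite /GRing.scale /= ea eb /dissipation; field.
Qed.

(** The second block row carries the voltage equation with its sign reversed. The off-diagonal part
    is then skew, so the quadratic form of the whole matrix reduces to the damping of [Rm] and
    [Gm]. *)
Definition circuit_mx (w : R) : 'M[R]_(s + r) :=
  block_mx Rm (Gam G0 G1 w) (- (Gam G0 G1 w)^T) Gm.

Lemma circuit_mx_continuous i j : continuous (fun w => circuit_mx w i j).
Proof.
have affine (a b : R) : continuous (fun w : R => w * a + (1 - w) * b).
  move=> w; apply: cvgD; apply: cvgM; try exact: cvg_cst; first exact: cvg_id.
  by apply: cvgB; [exact: cvg_cst | exact: cvg_id].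
have Gc k l : continuous (fun w => Gam G0 G1 w k l).
  rewrite (_ : (fun w => _) = (fun w => w * G1 k l + (1 - w) * G0 k l)); first exact: affine.
  by apply/funext => w; rewrite !mxE.
rewrite /circuit_mx; case: (split_ordP i) => i' ->; case: (split_ordP j) => j' ->.
- by under eq_fun do rewrite block_mxEul; exact: cst_continuous.
- by under eq_fun do rewrite block_mxEur; exact: Gc.
- under eq_fun do rewrite block_mxEdl entryN mxE.
  by move=> w; apply: cvgN; exact: Gc.
- by under eq_fun do rewrite block_mxEdr; exact: cst_continuous.
Qed.

(** Pairing a kernel vector [(c, e)] with itself removes the skew part and leaves two nonnegative
    damping terms with sum zero. A definite block kills its component; if only one block is known
    definite, the row without that block reduces to [Gam] or its transpose, and full column rank
    kills the other component. *)
Lemma circuit_mx_unit w :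
  (posdef Rm /\ posdef Gm) \/ (posdef Rm /\ \rank (Gam G0 G1 w) = r)
    \/ (posdef Gm /\ \rank (Gam G0 G1 w)^T = s) ->
  circuit_mx w \in unitmx.
Proof.
move=> cond; apply: unitmx_inj => x; rewrite -[x]vsubmxK.
set c := usubmx x; set e := dsubmx x.
rewrite /circuit_mx mul_block_col -[0]vsubmxK => /eq_col_mx.
rewrite (linear0 usubmx) (linear0 dsubmx) => -[h1 h2].
have q0 : (c^T *m Rm *m c) 0 0 + (e^T *m Gm *m e) 0 0 = 0.
  have : (c^T *m (Rm *m c + Gam G0 G1 w *m e)) 0 0 + (e^T *m (- (Gam G0 G1 w)^T *m c + Gm *m e)) 0 0 = 0.
    by rewrite h1 h2 !mulmx0 mxE addr0.
  rewrite !mulmxDr mulNmx mulmxN !mulmxA !entryD entryN [X in _ + (- X + _)]bilin_trmx trmxK.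
  by move=> <-; ring.
have := Rpsd.2 c; have := Gpsd.2 e => ge0 gc0.
have qc : (c^T *m Rm *m c) 0 0 = 0 by lra.
have qe : (e^T *m Gm *m e) 0 0 = 0 by lra.
have pd0 n (A : 'M[R]_n) (y : 'cV[R]_n) : posdef A -> (y^T *m A *m y) 0 0 = 0 -> y = 0.
  by move=> [_ Ap] y0; apply/eqP; apply/negPn/negP => /Ap; rewrite y0 ltxx.
have rank0 p q (A : 'M[R]_(p, q)) (y : 'cV[R]_q) : \rank A = q -> A *m y = 0 -> y = 0.
  move=> rA Ay; have fA : row_free A^T by rewrite /row_free mxrank_tr rA.
  apply/trmx_inj; rewrite trmx0; apply: (row_free_inj fA).
  by rewrite -trmx_mul Ay trmx0 mul0mx.
suff [-> ->] : c = 0 /\ e = 0 by rewrite ?(linear0 usubmx) ?(linear0 dsubmx).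
case: cond => [[Rp Gp]|[[Rp rk]|[Gp rk]]].
- by split; [exact: pd0 Rp qc | exact: pd0 Gp qe].
- have c0 : c = 0 by exact: pd0 Rp qc.
  split=> //; apply: (rank0 _ _ _ _ rk).
  by move: h1; rewrite c0 mulmx0 add0r.
- have e0 : e = 0 by exact: pd0 Gp qe.
  split=> //; apply: (rank0 _ _ _ _ rk).
  by move: h2; rewrite e0 mulmx0 addr0 mulNmx => /eqP; rewrite oppr_eq0 => /eqP.
Qed.

(** * A closed-loop solution with zero input *)

Section Autonomous.
Context (I : R -> 'cV[R]_s) (V : R -> 'cV[R]_r) (u : R -> R).
Context (sol : cl_solution L Rm C Gm G0 G1 B0 B1 Vs kd ki ubar (fun=> 0) I V u).
Context (Aunit : forall w, 0 <= w <= 1 -> circuit_mx w \in unitmx).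

Let dI := derive1 I.
Let dV := derive1 V.
Let v := derive1 u.

Let isdI : \forall t \near +oo, is_derive (t : R) 1 I (dI t).
Proof. by apply: near_gt0 => t /sol[[h _ _ _ _] _]; exact: is_derive_derive1. Qed.

Let isdV : \forall t \near +oo, is_derive (t : R) 1 V (dV t).
Proof. by apply: near_gt0 => t /sol[[_ h _ _ _] _]; exact: is_derive_derive1. Qed.

Let isddI : \forall t \near +oo, is_derive (t : R) 1 dI (derive1 dI t).
Proof. by apply: near_gt0 => t /sol[[_ _ h _ _] _]; exact: is_derive_derive1. Qed.

Let isddV : \forall t \near +oo, is_derive (t : R) 1 dV (derive1 dV t).
Proof. by apply: near_gt0 => t /sol[[_ _ _ h _] _]; exact: is_derive_derive1. Qed.

Let isdu : \forall t \near +oo, is_derive (t : R) 1 u (v t).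
Proof. by apply: near_gt0 => t /sol[[_ _ _ _ h] _]; exact: is_derive_derive1. Qed.

(** * Boundedness of all signals and of their derivatives *)

Let W t := storage (dI t) (dV t) (u t).

Let W_cvg : exists l, W t @[t --> +oo] --> (l : R).
Proof.
apply: (@nonincreasing_cvg _ W) => [t t0|t t0|t].
- exact: is_derive_storage sol t t0.
- by rewrite /= mul0r add0r oppr_le0 dissipation_ge0.
- exact: storage_ge0.
Qed.

(** The form bounds [A *m x], and a definite [A] can be inverted to recover [x]. *)
Let bnd_energy n (A : 'M[R]_n) (x : R -> 'cV[R]_n) : posdef A ->
  (forall t, ((x t)^T *m A *m x t) 0 0 <= 2 * W t) -> bnd x.
Proof.
move=> Apd xW; have [l /cvg_bnd bW] := W_cvg.
have b2W : bnd (fun t => 2 * W t) by apply: bndM => //; exact: bnd_cst.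
suff : bnd (fun t => invmx A *m (A *m x t)).
  by apply: bnd_near; near=> t; rewrite mulKmx// posdef_unit.
apply: bnd_mulmx; first exact: bnd_cst.
apply: possemidef_bnd; first exact: posdef_possemidef.
apply: bnd_le b2W; near=> t.
rewrite [leLHS]ger0_norm; last by have [_] := posdef_possemidef _ _ Apd; exact.
exact: le_trans (xW t) (ler_norm _).
Unshelve. all: by end_near. Qed.

Let energy_parts t : [/\ 0 <= ((dI t)^T *m L *m dI t) 0 0,
  0 <= ((dV t)^T *m C *m dV t) 0 0 & 0 <= ki * (u t - ubar) ^+ 2].
Proof.
have [_ Lp] := posdef_possemidef _ _ Lpd; have [_ Cp] := posdef_possemidef _ _ Cpd.
by split; [exact: Lp | exact: Cp | rewrite mulr_ge0 ?sqr_ge0 ?ltW].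
Qed.

Let bnd_dI : bnd dI.
Proof.
by apply: (bnd_energy _ _ _ Lpd) => t; have [] := energy_parts t; rewrite /W /storage; lra.
Qed.

Let bnd_dV : bnd dV.
Proof.
by apply: (bnd_energy _ _ _ Cpd) => t; have [] := energy_parts t; rewrite /W /storage; lra.
Qed.

Let bnd_u : bnd u.
Proof.
exists 1; apply: near_gt0 => t /sol[_ [/andP[u0 u1] _]].
by rewrite ger0_norm.
Qed.

Let bnd_inv : bnd (fun t => invmx (circuit_mx (u t))).
Proof.
have [K AK] := invmx_bound _ _ circuit_mx_continuous Aunit.
by exists K; apply: near_gt0 => t /sol[_ [u01 _]]; exact: AK.
Qed.

Let bnd_Bu : bnd (fun t => Bu B0 B1 (u t)).
Proof.
apply: bndD; apply: bndZ => //; try exact: bnd_cst.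
by apply: bndB => //; exact: bnd_cst.
Qed.

(** The storage does not see [I] and [V]. They are recovered from the circuit equations, read as a
    linear system with matrix [circuit_mx (u t)] and a bounded right-hand side. *)
Let bnd_IV : bnd (fun t => col_mx (I t) (V t)).
Proof.
have b : bnd (fun t => invmx (circuit_mx (u t)) *m
    col_mx (Bu B0 B1 (u t) *m Vs - L *m dI t) (- (C *m dV t))).
  apply: bnd_mulmx => //; apply: bnd_col_mx.
    by apply: bndB; apply: bnd_mulmx => //; exact: bnd_cst.
  by apply: bndN; apply: bnd_mulmx => //; exact: bnd_cst.
apply: bnd_near b; apply: near_gt0 => t /sol[_ [u01 [e1 e2 _ _ _]]].
have <- : circuit_mx (u t) *m col_mx (I t) (V t)
    = col_mx (Bu B0 B1 (u t) *m Vs - L *m dI t) (- (C *m dV t)).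
  rewrite mul_block_col; congr col_mx.
    by rewrite [RHS]addrC /dI e1 subrK.
  by rewrite /dV e2 opprB mulNmx addrC.
by rewrite mulKmx// Aunit.
Qed.

Let bnd_I : bnd I.
Proof.
by apply: bnd_near (bnd_usubmx _ _ _ _ bnd_IV); near=> t; rewrite col_mxKu.
Unshelve. all: by end_near. Qed.

Let bnd_V : bnd V.
Proof.
by apply: bnd_near (bnd_dsubmx _ _ _ _ bnd_IV); near=> t; rewrite col_mxKd.
Unshelve. all: by end_near. Qed.

(** Here and in the next two facts the signal stands on the right, so that [bnd_near], [bndC1_near]
    and [cvg_near] carry properties of the explicit expression over to it. *)
Let vE : \forall t \near +oo,
  kd^-1 * (0 - ki * (u t - ubar) - yout G0 G1 B0 B1 Vs (I t) (dI t) (V t) (dV t)) = v t.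
Proof. by apply: near_gt0 => t /sol[_ [_ [_ _ _ _ e5]]]; exact/esym/e5. Qed.

Let ddIE : \forall t \near +oo,
  invmx L *m (- (Rm *m dI t + Gam G0 G1 (u t) *m dV t
     + v t *: ((G1 - G0) *m V t - (B1 - B0) *m Vs))) = derive1 dI t.
Proof.
apply: near_gt0 => t /sol[_ [_ [_ _ e3 _ _]]].
by rewrite -[X in - X]e3 opprK mulKmx// posdef_unit.
Qed.

Let ddVE : \forall t \near +oo,
  invmx C *m ((Gam G0 G1 (u t))^T *m dI t + v t *: ((G1 - G0)^T *m I t) - Gm *m dV t)
    = derive1 dV t.
Proof.
apply: near_gt0 => t /sol[_ [_ [_ _ _ e4 _]]].
by rewrite -[X in _ *m X]e4 mulKmx// posdef_unit.
Qed.

Local Ltac bounded := repeat first [assumption | exact: bnd_cst | apply: bndN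
  | apply: bndD | apply: bnd_entry | apply: bnd_mulmx | apply: bnd_trmx
  | apply: bndM | apply: bndZ].

Local Ltac boundedC1 := repeat first [assumption | exact: bndC1_cst | apply: bndC1N
  | apply: bndC1D | apply: bndC1_entry | apply: bndC1_mulmx | apply: bndC1_trmx
  | apply: bndC1M | apply: bndC1_scale].

Let bnd_v : bnd v.
Proof. by apply: bnd_near vE _; rewrite /yout; bounded. Qed.

Let C1_I : bndC1 I. Proof. by split => //; exists dI. Qed.
Let C1_V : bndC1 V. Proof. by split => //; exists dV. Qed.
Let C1_u : bndC1 u. Proof. by split => //; exists v. Qed.

Let C1_dI : bndC1 dI.
Proof.
split; first exact: bnd_dI.
exists (derive1 dI); last exact: isddI.
apply: bnd_near ddIE _.
by rewrite /Gam; bounded.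
Qed.

Let C1_dV : bndC1 dV.
Proof.
split; first exact: bnd_dV.
exists (derive1 dV); last exact: isddV.
apply: bnd_near ddVE _.
by rewrite /Gam; bounded.
Qed.

(** [u] is assumed differentiable only once; its derivative inherits differentiability from the
    control law. *)
Let C1_v : bndC1 v.
Proof. by apply: bndC1_near vE _; rewrite /yout; boundedC1. Qed.

(** No third derivative is assumed: the extended dynamics express the second derivative through
    signals already known to be in [bndC1]. *)
Let C1_ddI : bndC1 (derive1 dI).
Proof. by apply: bndC1_near ddIE _; rewrite /Gam; boundedC1. Qed.

Let C1_ddV : bndC1 (derive1 dV).
Proof. by apply: bndC1_near ddVE _; rewrite /Gam; boundedC1. Qed.

(** * Decay of the dissipation and of its three terms *)

Let diss_cvg0 : dissipation (dI t) (dV t) (v t) @[t --> +oo] --> (0 : R).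
Proof.
have [l Wl] := W_cvg.
(* The vanishing supply term is kept so that [f] is literally the derivative given by
   [is_derive_storage] for zero input. *)
pose f t := 0 * v t - dissipation (dI t) (dV t) (v t).
have f0 : f t @[t --> +oo] --> (0 : R).
  apply: (@barbalat _ W _ l) => //.
    by apply: near_gt0 => t t0; exact: is_derive_storage sol t t0.
  by rewrite /f /dissipation; under eq_fun do rewrite expr2; boundedC1.
rewrite (_ : (fun t => _) = (fun t => - f t)).
  by rewrite -oppr0; exact: cvgN.
by apply/funext => t; rewrite /f; ring.
Qed.

Let v_cvg0 : v t @[t --> +oo] --> (0 : R).
Proof.
apply: cvg0_sqr; apply: (@cvg0_le _ _ (fun t => kd^-1 * dissipation (dI t) (dV t) (v t))).
  near=> t; rewrite exprn_ge0//= real_normK ?num_real// ler_pdivlMl//.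
  by rewrite /dissipation lerDr addr_ge0 ?(proj2 Rpsd) ?(proj2 Gpsd).
by rewrite -(mulr0 kd^-1); apply: cvgM => //; exact: cvg_cst.
Unshelve. all: by end_near. Qed.

Let RdI_cvg0 : Rm *m dI t @[t --> +oo] --> (0 : 'cV[R]_s).
Proof.
apply: (possemidef_cvg0 _ _ _ Rpsd); apply: cvg0_le diss_cvg0; near=> t.
by rewrite (proj2 Rpsd)/= /dissipation -addrA lerDl addr_ge0 ?(proj2 Gpsd)// mulr_ge0 ?sqr_ge0 ?ltW.
Unshelve. all: by end_near. Qed.

Let GdV_cvg0 : Gm *m dV t @[t --> +oo] --> (0 : 'cV[R]_r).
Proof.
apply: (possemidef_cvg0 _ _ _ Gpsd); apply: cvg0_le diss_cvg0; near=> t.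
rewrite (proj2 Gpsd)/= /dissipation addrAC lerDr addr_ge0 ?(proj2 Rpsd)//.
by rewrite mulr_ge0 ?sqr_ge0 ?ltW.
Unshelve. all: by end_near. Qed.

(** The bounded inverse of [circuit_mx (u t)] reduces convergence of both derivatives to that of the
    two block rows, uniformly in the three cases of (b). *)
Let dIdV_cvg0 :
  Rm *m dI t + Gam G0 G1 (u t) *m dV t @[t --> +oo] --> (0 : 'cV[R]_s) ->
  - (Gam G0 G1 (u t))^T *m dI t + Gm *m dV t @[t --> +oo] --> (0 : 'cV[R]_r) ->
  dI t @[t --> +oo] --> (0 : 'cV[R]_s) /\ dV t @[t --> +oo] --> (0 : 'cV[R]_r).
Proof.
move=> h1 h2.
have h : col_mx (dI t) (dV t) @[t --> +oo] --> (0 : 'cV[R]_(s + r)).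
  apply: cvg_near (cvg0_mulmx _ _ _ _ _ bnd_inv (cvg0_col_mx _ _ _ _ _ h1 h2)).
  apply: near_gt0 => t /sol[_ [u01 _]].
  by rewrite -mul_block_col -/(circuit_mx (u t)) mulKmx// Aunit.
split.
- by have := cvg0_usubmx _ _ _ _ h; under eq_fun do rewrite col_mxKu.
- by have := cvg0_dsubmx _ _ _ _ h; under eq_fun do rewrite col_mxKd.
Qed.

Let vZ_cvg0 n (x : R -> 'cV[R]_n) : bnd x -> v t *: x t @[t --> +oo] --> (0 : 'cV[R]_n).
Proof. exact: cvg0_scale. Qed.

(** * Convergence of the derivatives and of the duty cycle *)

Context (RGpd : posdef Rm \/ posdef Gm).

(** When [Rm] is definite, [dI] tends to zero, hence so does its derivative by Barbalat. The
    extended current equation then gives the first block row; the second follows from [dI] and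
    [GdV_cvg0]. The case of definite [Gm] exchanges the two rows. *)
Let dIdV0 : dI t @[t --> +oo] --> (0 : 'cV[R]_s) /\ dV t @[t --> +oo] --> (0 : 'cV[R]_r).
Proof.
have bG : bnd (fun t => Gam G0 G1 (u t)) by rewrite /Gam; bounded.
case: RGpd => [Rpd|Gpd].
- have dI0 : dI t @[t --> +oo] --> (0 : 'cV[R]_s).
    apply: cvg_near (cvg0_mulmx _ _ _ _ _ (bnd_cst (invmx Rm)) RdI_cvg0).
    by near=> t; rewrite mulKmx// posdef_unit.
  have ddI0 := barbalat_mx _ _ _ _ _ dI0 isddI C1_ddI.
  have LddI0 := cvg0_mulmx _ _ _ _ _ (bnd_cst L) ddI0.
  have b0 : v t *: ((G1 - G0) *m V t - (B1 - B0) *m Vs) @[t --> +oo] --> (0 : 'cV[R]_s).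
    by apply: vZ_cvg0; bounded.
  apply: dIdV_cvg0.
    apply: cvg_near (cvg0N _ (cvg0D _ _ LddI0 b0)).
    near=> t; rewrite /=; rewrite -(near ddIE t)// mulKVmx ?posdef_unit//.
    by rewrite opprD opprK addrK.
  have Gd0 : - (Gam G0 G1 (u t))^T *m dI t @[t --> +oo] --> (0 : 'cV[R]_r).
    by apply: cvg0_mulmx => //; apply: bndN; apply: bnd_trmx.
  exact: cvg0D.
- have dV0 : dV t @[t --> +oo] --> (0 : 'cV[R]_r).
    apply: cvg_near (cvg0_mulmx _ _ _ _ _ (bnd_cst (invmx Gm)) GdV_cvg0).
    by near=> t; rewrite mulKmx// posdef_unit.
  have ddV0 := barbalat_mx _ _ _ _ _ dV0 isddV C1_ddV.
  have CddV0 := cvg0_mulmx _ _ _ _ _ (bnd_cst C) ddV0.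
  have b0 : v t *: ((G1 - G0)^T *m I t) @[t --> +oo] --> (0 : 'cV[R]_r).
    by apply: vZ_cvg0; bounded.
  apply: dIdV_cvg0.
    have Gd0 := cvg0_mulmx _ _ _ _ _ bG dV0.
    exact: cvg0D.
  apply: cvg_near (cvg0B _ _ b0 CddV0).
  near=> t; rewrite /=; rewrite -(near ddVE t)// mulKVmx ?posdef_unit//.
  by rewrite mulNmx [in LHS](addrAC _ (v t *: _)) opprD addrCA subrr addr0 opprB addrC.
Unshelve. all: by end_near. Qed.

Lemma dI_cvg0 : derive1 I t @[t --> +oo] --> (0 : 'cV[R]_s).
Proof. exact: dIdV0.1. Qed.

Lemma dV_cvg0 : derive1 V t @[t --> +oo] --> (0 : 'cV[R]_r).
Proof. exact: dIdV0.2. Qed.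

Lemma du_cvg0 : derive1 u t @[t --> +oo] --> (0 : R).
Proof. exact: v_cvg0. Qed.

(** Every term pairs a vanishing derivative with a bounded signal. *)
Let yout_cvg0 : yout G0 G1 B0 B1 Vs (I t) (dI t) (V t) (dV t) @[t --> +oo] --> (0 : R).
Proof.
have [dI0 dV0] := dIdV0.
have bilin0 p q (x : R -> 'cV[R]_p) (A : 'M[R]_(p, q)) (y : R -> 'cV[R]_q) :
    x t @[t --> +oo] --> (0 : 'cV[R]_p) -> bnd y ->
    ((x t)^T *m A *m y t) 0 0 @[t --> +oo] --> (0 : R).
  move=> x0 by_; under eq_fun do rewrite bilin_trmx.
  by apply: cvg0_entry; apply: cvg0_mulmx => //; bounded.
by apply: cvg0B; first apply: cvg0B; apply: bilin0 => //; exact: bnd_cst.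
Qed.

Lemma u_cvg : u t @[t --> +oo] --> ubar.
Proof.
apply/subr_cvg0.
(* With zero input the control law reads [u - ubar = ki^-1 (- kd v - y)], and both [v] and [y]
   vanish in the limit. *)
apply: cvg_near (cvg0Mr ki^-1 _ (cvg0B _ _ (cvg0N _ (cvg0Mr kd _ v_cvg0)) yout_cvg0)).
near=> t; rewrite /=; rewrite -(near vE t)//=; field.
by rewrite !gt_eqF.
Unshelve. all: by end_near. Qed.

(** * Convergence to the operating point *)

Section OperatingPoint.
Context (Ibar : 'cV[R]_s) (Vstar : 'cV[R]_r).
Context (eqI : Gam G0 G1 ubar *m Vstar + Rm *m Ibar - Bu B0 B1 ubar *m Vs = 0).
Context (eqV : (Gam G0 G1 ubar)^T *m Ibar - Gm *m Vstar = 0).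
Context (rkA : \rank (block_mx Rm (Gam G0 G1 ubar) (Gam G0 G1 ubar)^T (- Gm)) = (s + r)%N).

(** Subtracting the equilibrium equations from the circuit equations shows that the invertible [A]
    maps the error [(I - Ibar, V - Vstar)] to terms driven by [ubar - u], [dI] and [dV], all of
    which vanish; [h1] and [h2] treat the two blocks of this image. *)
Lemma operating_point_cvg :
  I t @[t --> +oo] --> Ibar /\ V t @[t --> +oo] --> Vstar.
Proof.
pose A := block_mx Rm (Gam G0 G1 ubar) (Gam G0 G1 ubar)^T (- Gm).
have uA : A \in unitmx by rewrite -row_free_unit /row_free rkA.
have [dI0 dV0] := dIdV0.
have u0 : u t - ubar @[t --> +oo] --> (0 : R) by apply/subr_cvg0; exact: u_cvg.
have h1 : (ubar - u t) *: ((G1 - G0) *m V t - (B1 - B0) *m Vs) - L *m dI t @[t --> +oo]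
    --> (0 : 'cV[R]_s).
  have a0 : (ubar - u t) *: ((G1 - G0) *m V t - (B1 - B0) *m Vs) @[t --> +oo]
      --> (0 : 'cV[R]_s).
    apply: cvg0_scale; last by bounded.
    by under eq_fun do rewrite -opprB; exact: cvg0N.
  exact: (cvg0B _ _ a0 (cvg0_mulmx _ _ _ _ _ (bnd_cst L) dI0)).
have h2 : (ubar - u t) *: ((G1 - G0)^T *m I t) + C *m dV t @[t --> +oo]
    --> (0 : 'cV[R]_r).
  have a0 : (ubar - u t) *: ((G1 - G0)^T *m I t) @[t --> +oo] --> (0 : 'cV[R]_r).
    apply: cvg0_scale; last by bounded.
    by under eq_fun do rewrite -opprB; exact: cvg0N.
  exact: (cvg0D _ _ a0 (cvg0_mulmx _ _ _ _ _ (bnd_cst C) dV0)).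
have h : col_mx (I t - Ibar) (V t - Vstar) @[t --> +oo] --> (0 : 'cV[R]_(s + r)).
  apply: cvg_near (cvg0_mulmx _ _ _ _ _ (bnd_cst (invmx A)) (cvg0_col_mx _ _ _ _ _ h1 h2)).
  apply: near_gt0 => t /sol[_ [_ [e1 e2 _ _ _]]].
  rewrite -[RHS](mulKmx uA); congr (_ *m _); rewrite mul_block_col /dI /dV; congr col_mx.
    rewrite e1 (GamB _ _ G0 G1 (u t) ubar) (BuB _ _ B0 B1 (u t) ubar).
    (* Generalising the matrices keeps the distributivity rewrites from splitting [G1 - G0] and
       [B1 - B0]; entrywise, the claim is then linear arithmetic from [eqI]. *)
    move: eqI; move: (G1 - G0) (B1 - B0) (Gam _ _ ubar) (Bu _ _ ubar) => D E Gb Bb.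
    move=> /matrixP eqI'; apply/matrixP => i j; move: (eqI' i j).
    rewrite !(mulmxDl, mulmxDr, mulmxN, mulNmx, scalerDr, scalerN) -!scalemxAl.
    rewrite !(entryD, entryN, entryZ) entry0; lra.
  rewrite e2 (GamB _ _ G0 G1 (u t) ubar).
  move: (G1 - G0) => D; rewrite [(_ + _)^T]linearD /= [(_ *: _)^T]linearZ /=.
  move: eqV; move: (D^T) ((Gam _ _ ubar)^T) => {}D Gb.
  move=> /matrixP eqV'; apply/matrixP => i j; move: (eqV' i j).
  rewrite !(mulmxDl, mulmxDr, mulmxN, mulNmx, scalerDr, scalerN) -!scalemxAl.
  rewrite !(entryD, entryN, entryZ) entry0; lra.
split; apply/subr_cvg0.
- by have := cvg0_usubmx _ _ _ _ h; under eq_fun do rewrite col_mxKu.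
- by have := cvg0_dsubmx _ _ _ _ h; under eq_fun do rewrite col_mxKd.
Qed.

End OperatingPoint.
End Autonomous.
End ClosedLoop.

(** * Passivity, convergence and uniqueness assembled *)

Theorem theorem4 (R : realType) (s r m : nat)
  (L Rm : 'M[R]_s) (C Gm : 'M[R]_r) (G0 G1 : 'M[R]_(s, r))
  (B0 B1 : 'M[R]_(s, m)) (Vs : 'cV[R]_m)
  (Vstar : 'cV[R]_r) (ubar : R) (Ibar : 'cV[R]_s) (kd ki : R) :
  posdef L -> posdef C -> possemidef Rm -> possemidef Gm ->
  Vs != 0 ->
  (forall i, 0 < Vstar i 0) -> 0 < ubar < 1 ->
  Gam G0 G1 ubar *m Vstar + Rm *m Ibar - Bu B0 B1 ubar *m Vs = 0 ->
  (Gam G0 G1 ubar)^T *m Ibar - Gm *m Vstar = 0 ->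
  (forall (I : 'cV[R]_s) (V : 'cV[R]_r),
      col_mx ((G1 - G0) *m V - (B1 - B0) *m Vs) ((G1 - G0)^T *m I) != 0) ->
  0 < kd -> 0 < ki ->
  let cond_b :=
    (posdef Rm /\ posdef Gm)
    \/ (posdef Rm /\ forall w : R, 0 <= w <= 1 -> \rank (Gam G0 G1 w) = r)
    \/ (posdef Gm /\ forall w : R, 0 <= w <= 1 -> \rank (Gam G0 G1 w)^T = s) in
  (* (a) passivity of mu |-> dot u *)
  (exists S : 'cV[R]_s -> 'cV[R]_r -> 'cV[R]_s -> 'cV[R]_r -> R -> R,
     (forall a b c d e, 0 <= S a b c d e) /\
     forall (mu : R -> R) (I : R -> 'cV[R]_s) (V : R -> 'cV[R]_r) (u : R -> R),
       cl_solution L Rm C Gm G0 G1 B0 B1 Vs kd ki ubar mu I V u ->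
       forall t : R, 0 < t ->
         derivable (fun t => S (I t) (V t) ((derive1 I) t) ((derive1 V) t) (u t)) t 1 /\
         derive1 (fun t => S (I t) (V t) ((derive1 I) t) ((derive1 V) t) (u t)) t
           <= mu t * (derive1 u) t)
  /\
  (* (b) convergence to the set {dV = 0, dI = 0, du = 0, u = ubar} *)
  (cond_b ->
   forall (I : R -> 'cV[R]_s) (V : R -> 'cV[R]_r) (u : R -> R),
     cl_solution L Rm C Gm G0 G1 B0 B1 Vs kd ki ubar (fun _ => 0) I V u ->
     [/\ (derive1 I) t @[t --> +oo] --> 0, (derive1 V) t @[t --> +oo] --> 0,
         (derive1 u) t @[t --> +oo] --> 0 & u t @[t --> +oo] --> ubar])
  /\
  (* (c) convergence to the unique operating point *)
  (cond_b ->
   \rank (block_mx Rm (Gam G0 G1 ubar) (Gam G0 G1 ubar)^T (- Gm)) = (s + r)%N ->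
   (forall (I : R -> 'cV[R]_s) (V : R -> 'cV[R]_r) (u : R -> R),
     cl_solution L Rm C Gm G0 G1 B0 B1 Vs kd ki ubar (fun _ => 0) I V u ->
     [/\ I t @[t --> +oo] --> Ibar, V t @[t --> +oo] --> Vstar,
         (derive1 I) t @[t --> +oo] --> 0, (derive1 V) t @[t --> +oo] --> 0
       & u t @[t --> +oo] --> ubar])
   /\
   (forall (I0 : 'cV[R]_s) (V0 : 'cV[R]_r),
      Gam G0 G1 ubar *m V0 + Rm *m I0 - Bu B0 B1 ubar *m Vs = 0 ->
      (Gam G0 G1 ubar)^T *m I0 - Gm *m V0 = 0 ->
      I0 = Ibar /\ V0 = Vstar)).

Proof.
move=> Lpd Cpd Rpsd Gpsd _ _ _ eqI eqV _ kd0 ki0 cond_b.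
have Aunit : cond_b -> forall w, 0 <= w <= 1 -> circuit_mx Rm Gm G0 G1 w \in unitmx.
  move=> cb w w01; apply: circuit_mx_unit => //.
  case: cb => [RG|[[Rp rk]|[Gp rk]]]; first by left.
    by right; left; split=> //; exact: rk.
  by right; right; split=> //; exact: rk.
have RGpd : cond_b -> posdef Rm \/ posdef Gm.
  by case=> [[Rp _]|[[Rp _]|[Gp _]]]; [left | left | right].
split; [|split].
- exists (fun _ _ => storage L C ki ubar); split=> [_ _ c d w|mu I V u sol t t0].
    exact: storage_ge0.
  have [Sd Sv] := is_derive_storage _ _ _ _ _ _ _ _ _ _ _ _ Lpd Cpd kd0 _ _ _ _ sol t t0.
  split; first exact: Sd.
  by rewrite derive1E Sv lerBlDr lerDl; exact: dissipation_ge0.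
- move=> cb I V u sol; move/Aunit: (cb) => uA; move/RGpd: (cb) => pd; split.
  + exact: (dI_cvg0 _ _ _ _ _ _ _ _ _ _ _ _ Lpd Cpd Rpsd Gpsd kd0 ki0 _ _ _ sol uA pd).
  + exact: (dV_cvg0 _ _ _ _ _ _ _ _ _ _ _ _ Lpd Cpd Rpsd Gpsd kd0 ki0 _ _ _ sol uA pd).
  + exact: (du_cvg0 _ _ _ _ _ _ _ _ _ _ _ _ Lpd Cpd Rpsd Gpsd kd0 ki0 _ _ _ sol uA).
  + exact: (u_cvg _ _ _ _ _ _ _ _ _ _ _ _ Lpd Cpd Rpsd Gpsd kd0 ki0 _ _ _ sol uA pd).
- move=> cb rkA; split=> [I V u sol|I0 V0 eqI0 eqV0].
    move/Aunit: (cb) => uA; move/RGpd: (cb) => pd.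
    have [Icvg Vcvg] := operating_point_cvg _ _ _ _ _ _ _ _ _ _ _ _ Lpd Cpd Rpsd Gpsd
      kd0 ki0 _ _ _ sol uA pd _ _ eqI eqV rkA.
    split=> //.
    + exact: (dI_cvg0 _ _ _ _ _ _ _ _ _ _ _ _ Lpd Cpd Rpsd Gpsd kd0 ki0 _ _ _ sol uA pd).
    + exact: (dV_cvg0 _ _ _ _ _ _ _ _ _ _ _ _ Lpd Cpd Rpsd Gpsd kd0 ki0 _ _ _ sol uA pd).
    + exact: (u_cvg _ _ _ _ _ _ _ _ _ _ _ _ Lpd Cpd Rpsd Gpsd kd0 ki0 _ _ _ sol uA pd).
  (* Uniqueness: both equilibria have the same image under the invertible [A]. *)
  apply: eq_col_mx; move: rkA; set A := block_mx _ _ _ _ => rkA.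
  have uA : A \in unitmx by rewrite -row_free_unit /row_free rkA.
  apply: (can_inj (mulKmx uA)); rewrite !mul_block_col !mulNmx; congr col_mx; last first.
    by rewrite eqV eqV0.
  rewrite ![Rm *m _ + _]addrC; apply: (subIr (Bu B0 B1 ubar *m Vs)).
  by rewrite eqI eqI0.
Qed.
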